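(* Let $K$ be a field of characteristic zero, let $n$ be a positive integer, and write $\mathcal{M}=\mathcal{M}_n(K)$. Let $\mathcal{P} = \mathcal{M}[R_n] + K E_{n,n}$, and let $\Omega$ be the set of proper subalgebras $\mathcal{B}$ of $\mathcal{P}$ with $\mathcal{B}\ne\mathcal{M}[R_n]$. Let $\mathcal{B}\in\Omega$. Then $\dim_K \mathcal{B} \le n^2-2n+3$. Moreover, if $\mathcal{B}$ has the maximum dimension $n^2-2n+3$, then $\mathcal{B}$ is similar to one of $$\mathcal{M}E_{n,n} + \mathcal{M}[R_n,C_1] + K E_{1,1}, \qquad \mathcal{M}E_{n,n} + \mathcal{M}[R_n,R_{n-1}] + K E_{n-1,n-1}.$$
   Context: $\mathcal{M}_n(K)$ is the algebra of $n\times n$ matrices over $K$. A subalgebra of $\mathcal{M}$ (or of $\mathcal{P}$) is a $K$-linear subspace closed under matrix multiplication; it need not contain the identity matrix or have any unity. $E_{i,j}$ denotes the matrix in $\mathcal{M}$ with entry $1$ in row $i$, column $j$ and $0$ elsewhere. $\mathcal{M}[R_n]$ is the subalgebra of all matrices in $\mathcal{M}$ whose $n$-th row is zero; $\mathcal{M}[R_n,C_1]$ is the subalgebra of matrices whose $n$-th row and first column are zero; $\mathcal{M}[R_n,R_{n-1}]$ is the subalgebra of matrices whose $n$-th and $(n-1)$-th rows are zero. $\mathcal{M}E_{n,n}=\{ME_{n,n}: M\in\mathcal{M}\}$ is the set of matrices whose columns other than the $n$-th are zero. Subalgebras $\mathcal{A},\mathcal{B}\subset\mathcal{M}$ are similar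 if $\mathcal{A} = \{S^{-1}BS : B\in\mathcal{B}\}$ for some invertible $S\in\mathcal{M}$. (For $n=1$ the set $\Omega$ is empty, so the statement is vacuous.) *)

(* Defs.v *)
From HB Require Import structures.
From mathcomp Require Import all_boot all_order all_algebra.

Set Implicit Arguments.
Unset Strict Implicit.
Unset Printing Implicit Defensive.

Import GRing.Theory.
Local Open Scope ring_scope.

(* Matrices have size n.+1, so that the 1-based row and column numbers 1 and
   n.+1 are ord0 and ord_max. The row before the last is [penult]; for size 1
   there is no such row and [penult] degenerates to ord0. *)
Definition penult (n : nat) : 'I_n.+1 := inord n.-1.

Section MatrixSubspaces.

Variables (K : fieldType) (n : nat).

Local Notation M := 'M[K]_n.+1.

(* Not {aspace M}: a subalgebra here need not contain any unity. *)
Definition is_subalg (B : {vspace M}) : Prop :=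
  forall X Y : M, X \in B -> Y \in B -> X *m Y \in B.

(* {A | row i A = 0} and {A | col j A = 0}. *)
Definition zero_row (i : 'I_n.+1) : {vspace M} := lker (linfun (row i : M -> _)).
Definition zero_col (j : 'I_n.+1) : {vspace M} := lker (linfun (col j : M -> _)).

(* {A *m X | A : M}. *)
Definition left_multiples (X : M) : {vspace M} := limg (linfun (mulmxr X : M -> M)).

Definition similar_subspaces (A B : {vspace M}) : Prop :=
  exists2 S : M, S \in unitmx &
    forall X : M, X \in A <-> exists2 Y : M, Y \in B & X = invmx S *m Y *m S.

(* The matrices whose last row vanishes off the diagonal. *)
Definition parabolic : {vspace M} := (zero_row ord_max + <[delta_mx ord_max ord_max]>)%VS.

Definition Omega (B : {vspace M}) : Prop :=
  [/\ is_subalg B, (B <= parabolic)%VS, B <> parabolic & B <> zero_row ord_max].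

Definition extremal_col : {vspace M} :=
  (left_multiples (delta_mx ord_max ord_max)
   + (zero_row ord_max :&: zero_col ord0) + <[delta_mx ord0 ord0]>)%VS.

Definition extremal_row : {vspace M} :=
  (left_multiples (delta_mx ord_max ord_max)
   + (zero_row ord_max :&: zero_row (penult n)) + <[delta_mx (penult n) (penult n)]>)%VS.

End MatrixSubspaces.

Arguments zero_row K {n} i.
Arguments zero_col K {n} j.

(* Main.v *)
Require Import Defs.
From mathcomp Require Import all_boot all_order all_fingroup all_algebra zify.

Set Implicit Arguments.
Unset Strict Implicit.
Unset Printing Implicit Defensive.

Import GRing.Theory.
Local Open Scope ring_scope.

(** Write the size as [n.+1]. An element of the parabolic [P] is a block matrix
    with rows (A, y) and (0, d), where the corner A is an [n] x [n] matrix, y a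
    column and d a scalar; [corner] is multiplicative on [P]. The bound to prove
    is n^2 + 2, and there are two cases, according to the image of B under
    [corner].

    If the image is everything ([corner_full_zero_row]) and dim B >= n^2 + 2,
    then the kernel of [corner] on B has dimension at least 2, so it contains
    some (0, y) with d = 0 and y <> 0. Multiplying it on the left by B gives all
    columns. A commutator of elements of B has d = 0, and the commutators and
    their products give every corner when n > 1. So B contains the ideal of
    matrices with zero last row, which is a hyperplane of P, and B is
    not in Omega. When n = 1, P has dimension 3 = n^2 + 2, so that B = P.

    Otherwise the image is a proper subalgebra of the n x n matrices, and
    [proper_subalg_dim_or_stable] says that either its dimension is at most
    n^2 - n, and then dim B <= (n^2 - n) + (n + 1) < n^2 + 2, or it stabilizes a
    line of columns or a line of rows. In these two cases a change of basis
    puts the stable line along a basis vector, which places a conjugate of B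
    inside one of the two extremal algebras ([similar_extremal_col],
    [similar_extremal_row]). Both have dimension at most n^2 + 2, so if B
    reaches this dimension the inclusion is an equality.

    The result on proper subalgebras A comes from the trace form. The orthogonal
    of A is nonzero, and it is an A-bimodule. If it contains an X of rank at
    least 2, then X A is orthogonal to A and has dimension at least
    dim A - n (n - 2), so that dim A <= n^2 - n ([dim_subalg_rank]). If all its
    elements have rank at most 1, take one of them, X = u v with u a column
    and v a row. Were there Y and Z in A such that Y u is not a multiple of u
    and v Z not a multiple of v, then Y X + X Z = (Y u) v + u (v Z) would
    be an element of rank 2. Hence A stabilizes the line of u or the line
    of v. *)

(** * Proper subalgebras and the trace form *)

Lemma dimv_fullmx (K : fieldType) (m p : nat) :
  \dim {:'M[K]_(m, p)} = (m * p)%N.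
Proof. by rewrite dimvf. Qed.

Section Trace.
Variables (K : fieldType) (m : nat).
Implicit Types (U V A : {vspace 'M[K]_m}) (X Y Z : 'M[K]_m).

Lemma mxtrace_mulmx_mxvec X Y : \tr (X *m Y) = (mxvec X *m (mxvec Y^T)^T) 0 0.
Proof.
transitivity (\sum_i \sum_j X i j * Y j i).
  by apply: eq_bigr => i _; rewrite mxE.
rewrite mxE (reindex _ (curry_mxvec_bij m m)) /= pair_bigA.
by apply: eq_bigr => [[i j]] _ /=; rewrite [_^T _ _]mxE !mxvecE mxE.
Qed.

(** The injective map [g] is used to flatten matrices with or without a
    transposition: the trace form is the dot product of a flattened matrix with
    a flattened transpose. *)
Lemma row_free_vbasis (p : nat) V (g : {linear 'M[K]_m -> 'rV[K]_p}) :
  injective g -> row_free (\matrix_(i < \dim V) g (vbasis V)`_i).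
Proof.
move=> g_inj; apply: inj_row_free => v v0.
have := basis_free (vbasisP V); move/freeP/(_ (fun i => v 0 i)) => h.
apply/rowP=> i; rewrite mxE; apply: h; apply: g_inj.
rewrite linear0 linear_sum -[RHS]v0 mulmx_sum_row; apply: eq_bigr => j _.
by rewrite linearZ rowK.
Qed.

(** The trace form is nondegenerate: bases of [U] and of [V], flattened, give
    row free matrices with product zero. *)
Lemma dim_trace_orthogonal U V :
  (forall X Y, X \in U -> Y \in V -> \tr (X *m Y) = 0) ->
  (\dim U + \dim V <= m ^ 2)%N.
Proof.
move=> UV0.
have inj1 : injective (mxvec : 'M[K]_m -> _) by exact: can_inj mxvecK.
have inj2 : injective (mxvec \o trmx : 'M[K]_m -> _).
  exact: inj_comp inj1 (can_inj (@trmxK _ _ _)).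
have /eqP <- := row_free_vbasis U inj1; have /eqP <- := row_free_vbasis V inj2.
rewrite -[X in (_ + X <= _)%N]mxrank_tr -mulnn; apply: mulmx0_rank_max.
apply/matrixP=> i j; rewrite [RHS]mxE.
rewrite -[RHS](UV0 (vbasis U)`_i (vbasis V)`_j) ?mxtrace_mulmx_mxvec; last 2 first.
- by rewrite vbasis_mem // mem_nth // size_tuple.
- by rewrite vbasis_mem // mem_nth // size_tuple.
by rewrite !mxE; apply: eq_bigr => k _; rewrite !mxE.
Qed.

Lemma trace_orthogonal_neq0 V : (V != fullv)%VS ->
  exists2 X, X != 0 & forall Y, Y \in V -> \tr (X *m Y) = 0.
Proof.
move=> Vproper.
pose M := \matrix_(i < \dim V) mxvec ((vbasis V)`_i)^T.
have [] := boolP (kermx M^T == 0).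
  rewrite kermx_eq0 -row_leq_rank mxrank_tr => le_m; case/negP: Vproper.
  rewrite eqEdim subvf dimv_fullmx.
  exact: leq_trans le_m (rank_leq_row _).
case/rowV0Pn => x /sub_kermxP xM x0; exists (vec_mx x).
  by apply: contra_neq x0 => x0; rewrite -[x]vec_mxK x0 linear0.
move=> Y VY; rewrite (coord_vbasis VY) mulmx_sumr linear_sum big1 // => i _.
rewrite -scalemxAr linearZ /= mxtrace_mulmx_mxvec vec_mxK.
have /matrixP/(_ 0 i) := xM; rewrite [RHS]mxE => xMi.
suff -> : (x *m (mxvec ((vbasis V)`_i)^T)^T) 0 0 = 0 by rewrite mulr0.
by rewrite -[RHS]xMi !mxE; apply: eq_bigr => k _; rewrite !mxE.
Qed.

(** [V] is orthogonal to all left multiples of [X], and these have dimension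
    m * rank X, since they are the T R for R a row basis of [X]. *)
Lemma dim_annihilator V X : (forall Y, Y \in V -> X *m Y = 0) ->
  (\dim V + m * \rank X <= m ^ 2)%N.
Proof.
move=> XV0.
have /submxP[D defD] : (row_base X <= X)%MS by rewrite eq_row_base.
pose f := linfun (mulmxr (row_base X) : 'M[K]_(m, \rank X) -> 'M[K]_m).
have fE T : f T = T *m row_base X by rewrite lfunE.
have <- : \dim (limg f) = (m * \rank X)%N.
  rewrite limg_dim_eq ?dimv_fullmx //.
  apply/eqP; rewrite capfv -subv0; apply/subvP => T.
  rewrite memv_ker memv0 fE => /eqP T0; apply/eqP.
  by apply: (row_free_inj (row_base_free X)); rewrite T0 mul0mx.
rewrite addnC; apply: dim_trace_orthogonal => _ Y /memv_imgP[T _ ->] VY.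
by rewrite fE defD -!mulmxA XV0 // !mulmx0 mxtrace0.
Qed.

(** Left multiplication by [X] on [A] has a kernel of dimension at most
    m^2 - m rank X by [dim_annihilator], and an image orthogonal to [A] because
    tr (X Y Z) = 0 for Y and Z in [A]. *)
Lemma dim_subalg_rank A X : (forall Y Z, Y \in A -> Z \in A -> Y *m Z \in A) ->
  (forall Y, Y \in A -> \tr (X *m Y) = 0) ->
  (2 * \dim A + m * \rank X <= 2 * m ^ 2)%N.
Proof.
move=> Aalg XA0.
pose f := linfun (mulmx X : 'M[K]_m -> 'M[K]_m).
have fE T : f T = X *m T by rewrite lfunE.
have H3 := limg_ker_dim f A.
have H1 : (\dim (A :&: lker f) + m * \rank X <= m ^ 2)%N.
  apply: dim_annihilator => Y; rewrite memv_cap memv_ker fE.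
  by case/andP=> _ /eqP.
have H2 : (\dim (f @: A) + \dim A <= m ^ 2)%N.
  apply: dim_trace_orthogonal => _ Z /memv_imgP[Y AY ->] AZ.
  by rewrite fE -mulmxA XA0 ?Aalg.
have := leq_add H1 H2; rewrite addnACA addnAC -addnA addnCA addnA -addnA H3.
by rewrite -addnA addnC !mul2n -!addnn.
Qed.

(** The matrix is the product of the [m] x 2 matrix with columns u, w by the
    2 x [m] matrix with rows z, v, both of rank 2. *)
Lemma rank_two_dyads (u w : 'cV[K]_m) (v z : 'rV[K]_m) :
  u != 0 -> v != 0 -> ~~ (w^T <= u^T)%MS -> ~~ (z <= v)%MS ->
  \rank (w *m v + u *m z)%R = 2%N.
Proof.
have ind (a b : 'rV[K]_m) : a != 0 -> ~~ (b <= a)%MS -> row_free (col_mx b a).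
  move=> a0 ba; apply: inj_row_free => x.
  rewrite -[x]hsubmxK mul_row_col; set s := lsubmx x; set t := rsubmx x => E.
  have s0 : s = 0.
    apply: contraNeq ba => s0; rewrite [s]mx11_scalar mul_scalar_mx in E.
    have s00 : s 0 0 != 0.
      by apply: contra_neq s0 => s00; rewrite [s]mx11_scalar s00 raddf0.
    rewrite -(eqmx_scale b s00) (_ : _ *: b = - (t *m a)).
      by rewrite eqmx_opp submxMl.
    by apply/eqP; rewrite -addr_eq0 E.
  move: E; rewrite s0 mul0mx add0r [t]mx11_scalar mul_scalar_mx => /eqP.
  rewrite scaler_eq0 (negPf a0) orbF => /eqP ->; rewrite raddf0.
  by rewrite row_mx0.
move=> u0 v0 wu zv.
have -> : w *m v + u *m z = (col_mx u^T w^T)^T *m col_mx z v.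
  by rewrite tr_col_mx !trmxK mul_row_col addrC.
rewrite mxrankMfree ?ind // mxrank_tr.
rewrite -addsmxE addsmxC addsmxE.
by apply/eqP; rewrite -[_ == _]/(row_free _) ind // trmx_eq0.
Qed.

(** The orthogonal of [A] is a nonzero [A]-bimodule, and it is either large or
    made of matrices of rank at most 1, one of which provides [u] and [v]. *)
Lemma proper_subalg_dim_or_stable A :
    (forall Y Z, Y \in A -> Z \in A -> Y *m Z \in A) -> (A != fullv)%VS ->
  [\/ (\dim A + m <= m ^ 2)%N,
      exists2 u : 'cV[K]_m, u != 0 &
        forall Y, Y \in A -> ((Y *m u)^T <= u^T)%MS
    | exists2 v : 'rV[K]_m, v != 0 &
        forall Y, Y \in A -> (v *m Y <= v)%MS].
Proof.
move=> Aalg Aproper; have [leA|ltA] := leqP (\dim A + m) (m ^ 2); first exact: Or31.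
have rank1 X : (forall Y, Y \in A -> \tr (X *m Y) = 0) -> (\rank X <= 1)%N.
  move=> /(dim_subalg_rank Aalg); rewrite [(_ <= 1)%N]leqNgt => H.
  apply/negP => r2; move: (leq_trans (leq_add (leqnn _) (leq_mul (leqnn m) r2)) H).
  by rewrite [(m * 2)%N]mulnC -mulnDr leq_pmul2l // leqNgt ltA.
have [X X0 XA0] := trace_orthogonal_neq0 Aproper.
have [u [v defX]] : exists (u : 'cV_m) (v : 'rV_m), X = u *m v.
  have := rank1 X XA0; rewrite leq_eqVlt ltnS leqn0 mxrank_eq0 (negPf X0) orbF.
  move=> /eqP r1; move: (mulmx_base X); move: (col_base X) (row_base X).
  by rewrite r1 => u v <-; exists u, v.
have u0 : u != 0 by apply: contra_neq X0 => u0; rewrite defX u0 mul0mx.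
have v0 : v != 0 by apply: contra_neq X0 => v0; rewrite defX v0 mulmx0.
have basisP p (h : {linear 'M[K]_m -> 'rV[K]_p}) (t : 'rV_p) :
    all (fun Y => h Y <= t)%MS (vbasis A) -> forall Y, Y \in A -> (h Y <= t)%MS.
  move=> /allP hA Y /coord_vbasis ->; rewrite linear_sum summx_sub // => i _.
  by rewrite linearZ scalemx_sub // hA // mem_nth // size_tuple.
have [/basisP|] := boolP (all (fun Y => (trmx \o mulmxr u) Y <= u^T)%MS (vbasis A)).
  by move=> uA; apply: Or32; exists u.
case/allPn=> Y /vbasis_mem YA Yu.
have [/basisP|] := boolP (all (fun Z => mulmx v Z <= v)%MS (vbasis A)).
  by move=> vA; apply: Or33; exists v.
case/allPn=> Z /vbasis_mem ZA Zv.
(* With X = u v, this element of the orthogonal is the sum of the dyads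
   (Y u) v and u (v Z). *)
suff : (\rank (Y *m X + X *m Z)%R <= 1)%N.
  by rewrite defX (mulmxA Y) -(mulmxA u) rank_two_dyads.
apply: rank1 => T TA; rewrite mulmxDl linearD /= -!mulmxA.
by rewrite (XA0 (Z *m T)) ?Aalg // mxtrace_mulC -mulmxA XA0 ?Aalg // addr0.
Qed.
End Trace.

(** * Dimensions, changes of basis and similarity *)

Section Sizes.
Variables (K : fieldType).

(** [V] lies in the span of the elementary matrices at the positions outside
    the image of [h]. *)
Lemma dim_vanishing (m p : nat) (T : finType) (h : T -> 'I_m * 'I_p)
    (V : {vspace 'M[K]_(m, p)}) : injective h ->
  (forall X t, X \in V -> X (h t).1 (h t).2 = 0) -> (\dim V + #|T| <= m * p)%N.
Proof.
move=> h_inj V0; pose H := [set h t | t : T].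
have <- : #|H| = #|T| by rewrite card_imset.
have -> : (m * p)%N = #|{: 'I_m * 'I_p}| by rewrite card_prod !card_ord.
rewrite -(cardsC H) addnC leq_add2l cardE.
rewrite -(size_map (fun q : 'I_m * 'I_p => delta_mx q.1 q.2 : 'M[K]_(m, p))).
apply: leq_trans (dim_span _); apply: dimvS; apply/subvP => X VX.
rewrite [X]matrix_sum_delta; apply: memv_suml => i _; apply: memv_suml => j _.
have [/imsetP[t _ ijt]|ijH] := boolP ((i, j) \in H).
  by have := V0 X t VX; rewrite -ijt /= => ->; rewrite scale0r mem0v.
apply/memvZ/memv_span/mapP; exists (i, j) => //.
by rewrite mem_enum inE.
Qed.

Lemma unitmx_row (n : nat) (v : 'rV[K]_n) (a : 'I_n) : v != 0 ->
  exists2 S, S \in unitmx & delta_mx 0 a *m S = v.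
Proof.
case: n v a => [|n] v a v0; first by case: a.
have r1 : \rank v = 1%N by rewrite rank_rV v0.
(* The Gaussian elimination of the row v reads v = c e_0 R with c a nonzero
   scalar and R invertible; the transposition moves e_a to e_0. *)
exists (tperm_mx a ord0 *m (col_ebase v 0 0 *: row_ebase v)).
  rewrite unitmx_mul unitmx_perm unitmxZ ?row_ebase_unit //.
  have := col_ebase_unit v; rewrite unitmxE det_mx11 //.
have tperm_a : delta_mx 0 a *m tperm_mx a ord0 = delta_mx 0 ord0 :> 'rV[K]_n.+1.
  by rewrite -rowE; apply/rowP => j; rewrite !mxE tpermL eq_sym.
rewrite mulmxA tperm_a.
rewrite -[RHS]mulmx_ebase r1 {2}[col_ebase v]mx11_scalar mul_scalar_mx.
rewrite -scalemxAl -scalemxAr.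
congr (_ *: (_ *m _)); apply/rowP => j; rewrite !mxE eqxx /= andbT.
by rewrite eq_sym.
Qed.

(** Conjugation preserves dimensions, so the inclusion of the conjugate of [B]
    in [W] is an equality as soon as [W] is not larger than [B]. *)
Lemma similar_subspaces_of_sub (n : nat) (B W : {vspace 'M[K]_n.+1}) (S : 'M_n.+1) :
    S \in unitmx -> (forall X, X \in B -> S *m X *m invmx S \in W) ->
  (\dim B <= \dim W)%N /\ ((\dim W <= \dim B)%N -> similar_subspaces B W).
Proof.
move=> Su BW.
pose f := linfun (mulmxr (invmx S) \o mulmx S : 'M[K]_n.+1 -> 'M[K]_n.+1).
have fE X : f X = S *m X *m invmx S by rewrite lfunE.
have fK X : invmx S *m f X *m S = X.
  by rewrite fE !mulmxA mulVmx // mul1mx -mulmxA mulVmx // mulmx1.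
have dimf : \dim (f @: B) = \dim B.
  apply: limg_dim_eq; apply/eqP; rewrite -subv0; apply/subvP => X.
  rewrite memv_cap memv_ker memv0 => /andP[_ /eqP fX0].
  by rewrite -[X]fK fX0 mulmx0 mul0mx.
have fBW : (f @: B <= W)%VS.
  by apply/subvP => _ /memv_imgP[X BX ->]; rewrite fE BW.
split=> [|leWB]; first by rewrite -dimf dimvS.
have /eqP defW : (f @: B == W)%VS by rewrite eqEdim fBW dimf.
exists S => // X; split=> [BX | [Y]].
  by exists (f X); rewrite ?fK // -defW memv_img.
by rewrite -defW => /memv_imgP[Z BZ ->] ->; rewrite fK.
Qed.
End Sizes.

(** * The corner of a parabolic matrix *)

Section Corner.
Variables (K : fieldType) (n : nat).
Local Notation M := 'M[K]_n.+1.
Implicit Types (X Y : M).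

(** For J = [incl_mx] and e = [last_row], the identities J J^T = 1, e e^T = 1,
    J e^T = 0 and J^T J + e^T e = 1 express the block decomposition without
    casts: the blocks of X are J X J^T, J X e^T, e X J^T and e X e^T. *)
Definition incl_mx : 'M[K]_(n, n.+1) := rowsub (lift ord_max) 1%:M.
Definition last_row : 'rV[K]_n.+1 := delta_mx 0 ord_max.
Local Notation J := incl_mx.
Local Notation e := last_row.

Definition corner X : 'M[K]_n := J *m X *m J^T.

Lemma cornerE X i j : corner X i j = X (lift ord_max i) (lift ord_max j).
Proof.
rewrite /corner mul_rowsub_mx mul1mx -[_ *m _]trmxK trmx_mul trmxK.
by rewrite mul_rowsub_mx mul1mx !mxE.
Qed.

Lemma mul_incl_mx (p : nat) (A : 'M[K]_(n.+1, p)) :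
  J *m A = rowsub (lift ord_max) A.
Proof. by rewrite mul_rowsub_mx mul1mx. Qed.

Lemma incl_mxK : J *m J^T = 1%:M.
Proof.
rewrite mul_incl_mx; apply/matrixP=> i j.
by rewrite !mxE eq_sym (inj_eq (@lift_inj _ _)).
Qed.

Lemma last_row_mul (p : nat) (A : 'M[K]_(n.+1, p)) : e *m A = row ord_max A.
Proof. by rewrite -rowE. Qed.

Lemma last_incl_mx : e *m J^T = 0.
Proof.
rewrite last_row_mul; apply/rowP=> j; rewrite !mxE.
by rewrite lift_eqF.
Qed.

Lemma incl_last_mx : J *m e^T = 0.
Proof. by rewrite -[LHS]trmxK trmx_mul trmxK last_incl_mx trmx0. Qed.

Lemma last_rowK : e *m e^T = 1%:M.
Proof. by rewrite trmx_delta mul_delta_mx; apply/matrixP => i j; rewrite !ord1 !mxE. Qed.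

Lemma tr_last_mul : e^T *m e = delta_mx ord_max ord_max.
Proof. by rewrite trmx_delta mul_delta_mx. Qed.

Lemma incl_split : J^T *m J + e^T *m e = 1%:M.
Proof.
rewrite tr_last_mul; apply/matrixP=> i j; rewrite !mxE.
under eq_bigr => k _ do rewrite !mxE.
case: (unliftP ord_max i) => [i'|] ->; last first.
  rewrite big1 ?add0r ?eqxx /= => [|k _]; first by rewrite eq_sym.
  by rewrite lift_eqF mul0r.
rewrite lift_eqF addr0 (bigD1 i') //= eqxx mul1r big1 ?addr0 // => k ki.
by rewrite (inj_eq (@lift_inj _ _)) (negPf ki) mul0r.
Qed.


Lemma zero_rowP i X : reflect (forall j, X i j = 0) (X \in zero_row K i).
Proof.
rewrite memv_ker lfunE; apply: (iffP eqP) => [/rowP X0 j | X0].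
  by have := X0 j; rewrite !mxE.
by apply/rowP=> j; rewrite !mxE.
Qed.

Lemma zero_colP j X : reflect (forall i, X i j = 0) (X \in zero_col K j).
Proof.
rewrite memv_ker lfunE; apply: (iffP eqP) => [/colP X0 i | X0].
  by have := X0 i; rewrite !mxE.
by apply/colP=> i; rewrite !mxE.
Qed.

Lemma last_row_off_diag X :
  (forall j, X ord_max (lift ord_max j) = 0) -> e *m X = X ord_max ord_max *: e.
Proof.
move=> X0; rewrite last_row_mul; apply/rowP=> j; rewrite !mxE.
by case: (unliftP ord_max j) => [k|] ->; rewrite ?X0 ?lift_eqF ?mulr0 // !eqxx mulr1.
Qed.

Lemma parabolicP X : reflect (e *m X = X ord_max ord_max *: e) (X \in parabolic K n).
Proof.
apply: (iffP memv_addP) => [[Z /zero_rowP Z0 [_ /vlineP[k ->] ->]] | eX].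
  apply: last_row_off_diag => j.
  by rewrite !mxE Z0 lift_eqF andbF add0r mulr0.
exists (X - X ord_max ord_max *: delta_mx ord_max ord_max).
  apply/zero_rowP => j; move/rowP/(_ j): eX; rewrite last_row_mul !mxE !eqxx /= => ->.
  by rewrite subrr.
exists (X ord_max ord_max *: delta_mx ord_max ord_max); first exact: memvZ (memv_line _).
by rewrite subrK.
Qed.

Lemma parabolic_incl X : X \in parabolic K n -> e *m X *m J^T = 0.
Proof. by move/parabolicP->; rewrite -scalemxAl last_incl_mx scaler0. Qed.

Lemma parabolic_entry X j : X \in parabolic K n -> X ord_max (lift ord_max j) = 0.
Proof.
move/parabolicP/rowP/(_ (lift ord_max j)).
by rewrite last_row_mul !mxE lift_eqF mulr0.
Qed.

Lemma mul_incl_mxC X : X \in parabolic K n -> X *m J^T = J^T *m corner X.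
Proof.
move=> /parabolic_incl eX; rewrite -[X in LHS]mul1mx -incl_split !mulmxDl.
by rewrite -!mulmxA (mulmxA e) eX mulmx0 addr0 /corner !mulmxA.
Qed.

Lemma corner_mul X Y : Y \in parabolic K n ->
  corner (X *m Y) = corner X *m corner Y.
Proof.
by move=> PY; rewrite {1}/corner -!mulmxA mul_incl_mxC // /corner !mulmxA.
Qed.

Lemma last_entry_mul X Y : X \in parabolic K n ->
  (X *m Y) ord_max ord_max = X ord_max ord_max * Y ord_max ord_max.
Proof.
move/parabolicP=> eX.
have : (e *m (X *m Y)) 0 ord_max = (X ord_max ord_max *: (e *m Y)) 0 ord_max.
  by rewrite mulmxA eX -scalemxAl.
by rewrite !last_row_mul !mxE.
Qed.

Lemma parabolic_split X : X \in parabolic K n ->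
  X = J^T *m corner X *m J + J^T *m (J *m X *m e^T) *m e
      + X ord_max ord_max *: delta_mx ord_max ord_max.
Proof.
move=> /parabolicP eX; rewrite -{1}[X]mul1mx -incl_split mulmxDl -(mulmxA e^T) eX.
rewrite -scalemxAr tr_last_mul; congr (_ + _).
by rewrite /corner !mulmxA -[LHS]mulmx1 -incl_split mulmxDr !mulmxA.
Qed.

Definition corner_lfun := linfun (mulmxr J^T \o mulmx J : M -> 'M[K]_n).

Lemma corner_lfunE X : corner_lfun X = corner X.
Proof. by rewrite lfunE. Qed.

Lemma mulmx_last_diag X i j :
  (X *m (delta_mx ord_max ord_max : M)) i j = X i ord_max *+ (j == ord_max).
Proof.
rewrite mxE (bigD1 ord_max) //= big1 ?addr0 => [|k /negPf kmax]; rewrite !mxE.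
  by rewrite eqxx mulr_natr.
by rewrite kmax mulr0.
Qed.

Lemma left_multiples_last X :
  reflect (forall i j, X i (lift ord_max j) = 0)
          (X \in left_multiples (delta_mx ord_max ord_max : M)).
Proof.
apply: (iffP memv_imgP) => [[A _ ->] i j | X0].
  by rewrite lfunE /= mulmx_last_diag lift_eqF.
exists X; rewrite ?memvf // lfunE /=; apply/matrixP => i j.
rewrite mulmx_last_diag; case: (unliftP ord_max j) => [k|] ->.
  by rewrite lift_eqF X0.
by rewrite eqxx.
Qed.

Lemma dim_parabolic : (\dim (parabolic K n) + n <= n.+1 * n.+1)%N.
Proof.
pose h (j : 'I_n) := (@ord_max n, lift ord_max j).
rewrite -[X in (_ + X <= _)%N]card_ord; apply: (@dim_vanishing _ _ _ _ h).
  by move=> j k /(congr1 snd) /lift_inj.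
by move=> X j /= /parabolic_entry.
Qed.

(** [zero_row] is a hyperplane of [parabolic]: an element outside it yields
    the diagonal unit that spans the quotient. *)
Lemma zero_row_maximal (B : {vspace M}) :
    (zero_row K ord_max <= B)%VS -> (B <= parabolic K n)%VS ->
  B = zero_row K ord_max \/ B = parabolic K n.
Proof.
move=> RB BP; have [BR|] := boolP (B <= zero_row K ord_max)%VS.
  by left; apply/eqP; rewrite eqEsubv BR.
case/subvPn=> X BX notRX; right; apply/eqP; rewrite eqEsubv BP subv_add RB /=.
have /memv_addP[Z RZ [_ /vlineP[k ->] defX]] := subvP BP X BX.
have k0 : k != 0.
  by apply: contraNneq notRX => k0; rewrite defX k0 scale0r addr0.
rewrite -memvE -[delta_mx _ _](scalerK k0) memvZ //.
by rewrite (_ : k *: _ = X - Z) ?memvB ?(subvP RB Z) // defX addrC addKr.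
Qed.

(** The corners of elements of [B] are arbitrary, so [B] absorbs one nonzero
    element of its kernel with zero diagonal entry into all last columns; the
    remaining task is to lift elementary matrices of the corner with d = 0,
    which commutators do when 1 < n. *)
Lemma corner_full_zero_row (B : {vspace M}) :
    is_subalg B -> (B <= parabolic K n)%VS ->
    (corner_lfun @: B = fullv)%VS -> (1 < n)%N -> (n ^ 2 + 2 <= \dim B)%N ->
  (zero_row K ord_max <= B)%VS.
Proof.
move=> Balg BP Bfull n1 dimB.
have inP X : X \in B -> X \in parabolic K n by apply: (subvP BP).
have lift_corner A : exists2 X, X \in B & corner X = A.
  have : A \in (corner_lfun @: B)%VS by rewrite Bfull memvf.
  by case/memv_imgP => X BX ->; exists X; rewrite ?corner_lfunE.
pose U := (B :&: lker corner_lfun)%VS.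
have dimU : (2 <= \dim U)%N.
  have := limg_ker_dim corner_lfun B; rewrite Bfull dimv_fullmx mulnn.
  by rewrite -/U addnC => dimE; move: dimB; rewrite -dimE leq_add2l.
pose g := linfun (mulmxr e^T \o mulmx e : M -> 'M[K]_1).
have gE X : g X = e *m X *m e^T by rewrite lfunE.
(* On the kernel U, of dimension at least 2, the last diagonal entry is a
   linear form, which vanishes on some nonzero Z. *)
have [Z [BZ cZ0 eZ0 Z0]] :
    exists Z, [/\ Z \in B, corner Z = 0, Z ord_max ord_max = 0 & Z != 0].
  have U'0 : (U :&: lker g != 0)%VS.
    rewrite -dimv_eq0 -lt0n; have := limg_ker_dim g U.
    have : (\dim (g @: U) <= 1)%N.
      by have := dimvS (subvf (g @: U)); rewrite dimv_fullmx.
    move: dimU; case: (\dim (U :&: _)) => // dimU le1 dimE.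
    by move: dimU; rewrite -dimE add0n ltnNge le1.
  exists (vpick (U :&: lker g)%VS).
  have := memv_pick (U :&: lker g); rewrite vpick0 memv_cap [in X in X && _]memv_cap.
  case/andP=> /andP[BZ]; rewrite !memv_ker corner_lfunE => /eqP cZ /eqP gZ.
  split=> //; have := gZ; rewrite gE (parabolicP _ (inP _ BZ)).
  rewrite -scalemxAl last_rowK => /matrixP/(_ 0 0).
  by rewrite !mxE mulr1.
have [w defZ] : exists w : 'cV_n, Z = J^T *m w *m e.
  exists (J *m Z *m e^T); rewrite {1}(parabolic_split (inP _ BZ)) cZ0 eZ0.
  by rewrite scale0r mulmx0 mul0mx add0r addr0.
have [k wk] : exists k, w k 0 != 0.
  apply/existsP; apply: contraNT Z0; rewrite negb_exists => /forallP w0.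
  rewrite defZ (_ : w = 0) ?mulmx0 ?mul0mx //.
  by apply/colP=> k; rewrite [RHS]mxE; apply/eqP; rewrite -[_ == _]negbK w0.
have lastB (y : 'cV[K]_n) : J^T *m y *m e \in B.
  (* This corner maps w to y. *)
  have [X BX cX] := lift_corner (y *m ((w k 0)^-1 *: delta_mx 0 k)).
  suff -> : J^T *m y *m e = X *m Z by apply: Balg.
  rewrite defZ !mulmxA; congr (_ *m _).
  rewrite (mul_incl_mxC (inP _ BX)) -mulmxA; congr (_ *m _).
  have row_w : row k w = (w k 0)%:M by rewrite [LHS]mx11_scalar mxE.
  rewrite cX -mulmxA -scalemxAl -rowE row_w scale_scalar_mx mulVf //.
  by rewrite mulmx1.
have innerB X : X \in B -> X ord_max ord_max = 0 -> J^T *m corner X *m J \in B.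
  move=> BX X0; have := parabolic_split (inP _ BX); rewrite X0 scale0r addr0.
  set a := _ *m J; set b := _ *m e => defX.
  by rewrite -(addrK b a) -defX memvB // lastB.
(* X |-> d is multiplicative with commutative values, so it kills commutators. *)
have commB A A' : J^T *m (A *m A' - A' *m A) *m J \in B.
  have [X BX cX] := lift_corner A; have [Y BY cY] := lift_corner A'.
  have -> : A *m A' - A' *m A = corner (X *m Y - Y *m X).
    by rewrite -cX -cY -!corner_mul ?inP // -!corner_lfunE linearB.
  apply: innerB; first by rewrite memvB ?Balg.
  by rewrite mxE [X in _ + X]mxE !last_entry_mul ?inP // mulrC subrr.
have offdiagB i j : i != j -> J^T *m delta_mx i j *m J \in B.
  move=> ij; have := commB (delta_mx i i) (delta_mx i j).
  by rewrite mul_delta_mx mul_delta_mx_0 1?eq_sym // subr0.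
have deltaB i j : J^T *m delta_mx i j *m J \in B.
  have [<-{j}|] := eqVneq i j; last exact: offdiagB.
  (* E_ii = E_ik' E_k'i with k' <> i, which exists because 1 < n. *)
  have [k' ki] : exists k' : 'I_n, k' != i.
    exists (if val i == 0%N then Ordinal n1 else Ordinal (ltnW n1)).
    by rewrite -(inj_eq val_inj); case: (val i).
  rewrite -(mul_delta_mx k').
  rewrite (_ : J^T *m _ *m J =
    (J^T *m delta_mx i k' *m J) *m (J^T *m delta_mx k' i *m J)).
    by apply: Balg; apply: offdiagB; rewrite // eq_sym.
  by rewrite -!mulmxA (mulmxA J) incl_mxK mul1mx.
apply/subvP => X /zero_rowP X0.
have PX : X \in parabolic K n.
  by apply/parabolicP; apply: last_row_off_diag => j; apply: X0.
rewrite (parabolic_split PX) X0 scale0r addr0 memvD ?lastB //.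
rewrite [corner X]matrix_sum_delta mulmx_sumr mulmx_suml memv_suml // => i _.
rewrite mulmx_sumr mulmx_suml memv_suml // => j _.
by rewrite -scalemxAr -scalemxAl memvZ.
Qed.

End Corner.

(** * Change of basis in the corner *)

Section Conj.
Variables (K : fieldType) (n : nat) (S0 : 'M[K]_n) (S0u : S0 \in unitmx).
Local Notation J := (incl_mx K n).
Local Notation e := (last_row K n).

(** The block diagonal matrix with blocks [S0] and 1. *)
Definition extend_mx : 'M[K]_n.+1 := J^T *m S0 *m J + e^T *m e.
Local Notation S := extend_mx.

Lemma extend_mx_incl : S *m J^T = J^T *m S0.
Proof.
by rewrite mulmxDl -!mulmxA incl_mxK last_incl_mx !mulmx0 mulmx1 addr0.
Qed.

Lemma incl_extend_mx : J *m S = S0 *m J.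
Proof.
by rewrite mulmxDr !mulmxA incl_mxK incl_last_mx mul0mx mul1mx addr0.
Qed.

Lemma last_extend_mx : e *m S = e.
Proof.
by rewrite mulmxDr !mulmxA last_incl_mx last_rowK !mul0mx mul1mx add0r.
Qed.

Lemma extend_mx_unit : S \in unitmx.
Proof.
have : S *m (J^T *m invmx S0 *m J + e^T *m e) = 1%:M.
  rewrite mulmxDr !mulmxA extend_mx_incl -(mulmxA _ S0) mulmxV // mulmx1.
  rewrite mulmxDl -(mulmxA _ J) incl_last_mx mulmx0 add0r -(mulmxA e^T) last_rowK.
  by rewrite mulmx1 incl_split.
by case/mulmx1_unit.
Qed.

Lemma parabolic_conj X : X \in parabolic K n -> S *m X *m invmx S \in parabolic K n.
Proof.
have Su := extend_mx_unit.
have eV : e *m invmx S = e by rewrite -{1}last_extend_mx mulmxK.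
move=> /parabolicP eX; apply/parabolicP; apply: last_row_off_diag => j.
have : (e *m (S *m X *m invmx S)) 0 (lift ord_max j) = 0.
  rewrite !mulmxA last_extend_mx eX -scalemxAl eV !mxE lift_eqF andbF.
  by rewrite mulr0.
by rewrite last_row_mul mxE.
Qed.

Lemma corner_conj X : corner (S *m X *m invmx S) = S0 *m corner X *m invmx S0.
Proof.
have Su := extend_mx_unit.
have VJ : invmx S *m J^T = J^T *m invmx S0.
  apply: (can_inj (mulKmx Su)); rewrite mulKVmx // mulmxA extend_mx_incl.
  by rewrite mulmxK.
by rewrite /corner !mulmxA incl_extend_mx -!mulmxA VJ.
Qed.
End Conj.

(** * The two extremal algebras *)

Section Extremal.
Variables (K : fieldType) (n : nat).
Implicit Types X : 'M[K]_n.+2.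

Lemma lift_max0 : lift ord_max ord0 = ord0 :> 'I_n.+2.
Proof. exact: val_inj. Qed.

Lemma lift_max_penult : lift ord_max ord_max = penult n.+1 :> 'I_n.+2.
Proof. by apply: ord_inj; rewrite lift_max inordK. Qed.

Lemma memv_add3 (V : vectType K) (A B C : {vspace V}) v :
  [|| v \in A, v \in B | v \in C] -> v \in (A + B + C)%VS.
Proof.
case/or3P; apply: subvP; rewrite ?addvSr // (subv_trans _ (addvSl _ C)) //.
  exact: addvSl.
exact: addvSr.
Qed.

Lemma delta_left_multiples i :
  delta_mx i ord_max \in left_multiples (delta_mx ord_max ord_max : 'M[K]_n.+2).
Proof. by apply/left_multiples_last => k j; rewrite mxE lift_eqF andbF. Qed.

Lemma delta_zero_row (r i j : 'I_n.+2) : r != i -> delta_mx i j \in zero_row K r.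
Proof. by move=> ri; apply/zero_rowP=> k; rewrite mxE (negPf ri). Qed.

Lemma delta_zero_col (c i j : 'I_n.+2) : c != j -> delta_mx i j \in zero_col K c.
Proof. by move=> cj; apply/zero_colP=> k; rewrite mxE (negPf cj) andbF. Qed.

(** Each elementary matrix either lies in one of the three summands or has a
    zero coefficient in [X]. *)
Lemma memv_extremal_col X : X \in parabolic K n.+1 ->
  (forall k, corner X (lift ord0 k) ord0 = 0) -> X \in extremal_col K n.+1.
Proof.
move=> PX X0; rewrite [X]matrix_sum_delta.
apply: memv_suml => i _; apply: memv_suml => j _.
case: (unliftP ord_max j) => [j'|] ->; last first.
  by rewrite memvZ // memv_add3 // delta_left_multiples.
case: (unliftP ord_max i) => [i'|] ->; last by rewrite parabolic_entry // scale0r mem0v.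
rewrite -cornerE; case: (unliftP ord0 j') => [j''|] ->; last first.
  case: (unliftP ord0 i') => [i''|] ->; first by rewrite X0 scale0r mem0v.
  by rewrite lift_max0 memvZ // memv_add3 // memv_line !orbT.
rewrite memvZ // memv_add3 // memv_cap delta_zero_row ?eq_liftF //.
by rewrite -{1}lift_max0 delta_zero_col ?orbT // (inj_eq lift_inj) eq_liftF.
Qed.

Lemma memv_extremal_row X : X \in parabolic K n.+1 ->
  (forall k, corner X ord_max (lift ord_max k) = 0) -> X \in extremal_row K n.+1.
Proof.
move=> PX X0; rewrite [X]matrix_sum_delta.
apply: memv_suml => i _; apply: memv_suml => j _.
case: (unliftP ord_max j) => [j'|] ->; last first.
  by rewrite memvZ // memv_add3 // delta_left_multiples.
case: (unliftP ord_max i) => [i'|] ->; last by rewrite parabolic_entry // scale0r mem0v.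
rewrite -cornerE; case: (unliftP ord_max i') => [i''|] ->; last first.
  case: (unliftP ord_max j') => [j''|] ->; first by rewrite X0 scale0r mem0v.
  by rewrite lift_max_penult memvZ // memv_add3 // memv_line !orbT.
rewrite memvZ // memv_add3 // memv_cap delta_zero_row ?eq_liftF //.
by rewrite -lift_max_penult delta_zero_row ?orbT // (inj_eq lift_inj) eq_liftF.
Qed.

(** Besides the [n.+1] zeros of the last row, [W] has [n] zeros in the corner,
    and n.+2 ^ 2 - (2 * n + 1) = n.+1 ^ 2 + 2. *)
Lemma dim_extremal (W : {vspace 'M[K]_n.+2}) (h : 'I_n -> 'I_n.+1 * 'I_n.+1) :
    injective h ->
    (forall X, X \in W ->
       X \in parabolic K n.+1 /\ forall k, corner X (h k).1 (h k).2 = 0) ->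
  (\dim W <= n.+1 ^ 2 + 2)%N.
Proof.
move=> h_inj W0.
pose g (t : 'I_n.+1 + 'I_n) : 'I_n.+2 * 'I_n.+2 := match t with
  | inl j => (ord_max, lift ord_max j)
  | inr k => (lift ord_max (h k).1, lift ord_max (h k).2) end.
have g_inj : injective g.
  case=> [j|k] [j'|k'] /= E; have E1 := congr1 fst E; have E2 := congr1 snd E.
  - by rewrite (lift_inj E2).
  - by move/eqP: E1; rewrite eq_liftF.
  - by move/eqP: E1; rewrite lift_eqF.
  - congr inr; apply: h_inj; rewrite [h k]surjective_pairing [h k']surjective_pairing.
    by rewrite (lift_inj E1) (lift_inj E2).
have := @dim_vanishing _ _ _ _ g W g_inj; rewrite card_sum !card_ord => H.
suff: (\dim W + (n.+1 + n) <= n.+2 * n.+2)%N by lia.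
apply: H => X [j|k] /W0[PX X0] /=; first exact: parabolic_entry.
by rewrite -cornerE.
Qed.

Lemma dim_extremal_col : (\dim (extremal_col K n.+1) <= n.+1 ^ 2 + 2)%N.
Proof.
apply: (@dim_extremal _ (fun k => (lift ord0 k, ord0))).
  by move=> k k' /(congr1 fst) /lift_inj.
move=> X /memv_addP[Y /memv_addP[Y1 /left_multiples_last Y1_0 [Y2]]].
rewrite memv_cap => /andP[/zero_rowP Y2r /zero_colP Y2c ->].
case=> _ /vlineP[k ->] ->; split=> [|i].
  apply/parabolicP; apply: last_row_off_diag => j.
  by rewrite !mxE Y1_0 Y2r mulr0 !addr0.
rewrite cornerE !mxE Y1_0 /= lift_max0 Y2c -[X in _ == X]lift_max0.
by rewrite (inj_eq lift_inj) lift_eqF mulr0 !addr0.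
Qed.

Lemma dim_extremal_row : (\dim (extremal_row K n.+1) <= n.+1 ^ 2 + 2)%N.
Proof.
apply: (@dim_extremal _ (fun k => (ord_max, lift ord_max k))).
  by move=> k k' /(congr1 snd) /lift_inj.
move=> X /memv_addP[Y /memv_addP[Y1 /left_multiples_last Y1_0 [Y2]]].
rewrite memv_cap -lift_max_penult => /andP[/zero_rowP Y2r /zero_rowP Y2c ->].
case=> _ /vlineP[k ->] ->; split=> [|i].
  apply/parabolicP; apply: last_row_off_diag => j.
  by rewrite !mxE Y1_0 Y2r eq_liftF mulr0 !addr0.
by rewrite cornerE !mxE Y1_0 Y2c !(inj_eq lift_inj) lift_eqF andbF mulr0 !addr0.
Qed.

(** In a basis of the corner that starts with [u], every corner has a first
    column that vanishes off the diagonal. *)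
Lemma similar_extremal_col (B : {vspace 'M[K]_n.+2}) (u : 'cV[K]_n.+1) :
    (B <= parabolic K n.+1)%VS -> u != 0 ->
    (forall X, X \in B -> ((corner X *m u)^T <= u^T)%MS) ->
  (\dim B <= \dim (extremal_col K n.+1))%N /\
  ((\dim (extremal_col K n.+1) <= \dim B)%N -> similar_subspaces B (extremal_col K n.+1)).
Proof.
move=> BP u0 Bu.
have [S1 S1u S1e] : exists2 S, S \in unitmx & delta_mx 0 ord0 *m S = u^T.
  by apply: unitmx_row; rewrite trmx_eq0.
pose S0 := invmx S1^T.
have S0u : S0 \in unitmx by rewrite unitmx_inv unitmx_tr.
have S0_u : S0 *m u = delta_mx ord0 0.
  by rewrite -[u]trmxK -S1e trmx_mul trmx_delta mulmxA mulVmx ?unitmx_tr // mul1mx.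
have VS0 : invmx S0 *m delta_mx ord0 0 = u by rewrite -S0_u mulKmx.
apply: (similar_subspaces_of_sub (extend_mx_unit S0u)) => X BX.
apply: memv_extremal_col; first by apply: parabolic_conj => //; apply: (subvP BP).
move=> k; rewrite corner_conj //.
have /sub_rVP[c Xu] := Bu X BX.
have {}Xu : corner X *m u = c *: u by apply: trmx_inj; rewrite Xu linearZ.
have : (S0 *m corner X *m invmx S0) *m delta_mx ord0 0 = c *: delta_mx ord0 0 :> 'cV_n.+1.
  by rewrite -mulmxA VS0 -mulmxA Xu -scalemxAr S0_u.
by rewrite -colE => /colP/(_ (lift ord0 k)); rewrite !mxE lift_eqF mulr0.
Qed.

(** The dual of [similar_extremal_col]: the new basis ends with the stable
    row [v]. *)
Lemma similar_extremal_row (B : {vspace 'M[K]_n.+2}) (v : 'rV[K]_n.+1) :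
    (B <= parabolic K n.+1)%VS -> v != 0 ->
    (forall X, X \in B -> (v *m corner X <= v)%MS) ->
  (\dim B <= \dim (extremal_row K n.+1))%N /\
  ((\dim (extremal_row K n.+1) <= \dim B)%N -> similar_subspaces B (extremal_row K n.+1)).
Proof.
move=> BP v0 Bv.
have [S0 S0u S0e] := unitmx_row ord_max v0.
apply: (similar_subspaces_of_sub (extend_mx_unit S0u)) => X BX.
apply: memv_extremal_row; first by apply: parabolic_conj => //; apply: (subvP BP).
move=> k; rewrite corner_conj //.
have /sub_rVP[c vX] := Bv X BX.
have : delta_mx 0 ord_max *m (S0 *m corner X *m invmx S0)
    = c *: delta_mx 0 ord_max :> 'rV_n.+1.
  by rewrite mulmxA [_ *m (S0 *m _)]mulmxA S0e vX -scalemxAl -S0e mulmxK.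
by rewrite -rowE => /rowP/(_ (lift ord_max k)); rewrite !mxE lift_eqF andbF mulr0.
Qed.

End Extremal.

(** * Subalgebras in Omega *)

Theorem theorem3p3 (K : fieldType) (charK0 : [pchar K] =i pred0) (n : nat)
    (B : {vspace 'M[K]_n.+1}) (BOmega : Omega B) :
  (\dim B <= n.+1 ^ 2 + 3 - 2 * n.+1)%N /\
  (\dim B = (n.+1 ^ 2 + 3 - 2 * n.+1)%N ->
   similar_subspaces B (extremal_col K n) \/
   similar_subspaces B (extremal_row K n)).
Proof.
have -> : (n.+1 ^ 2 + 3 - 2 * n.+1 = n ^ 2 + 2)%N by lia.
case: BOmega => Balg BP BneP Bne0.
have not_sup : ~~ (zero_row K ord_max <= B)%VS.
  by apply/negP => /zero_row_maximal/(_ BP)[].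
(* In size 1 a zero last row means a zero matrix. *)
case: n => [|n] in B Balg BP BneP Bne0 not_sup *.
  case/negP: not_sup; apply/subvP => X /zero_rowP X0.
  rewrite (_ : X = 0) ?mem0v //; apply/matrixP=> i j.
  by rewrite mxE (_ : i = ord_max) ?X0 // !ord1.
pose A := (corner_lfun K n.+1 @: B)%VS.
have inP X : X \in B -> X \in parabolic K n.+1 by apply: (subvP BP).
have inA X : X \in B -> corner X \in A by move=> BX; rewrite -corner_lfunE memv_img.
have Aalg Y Z : Y \in A -> Z \in A -> Y *m Z \in A.
  move=> /memv_imgP[X BX ->] /memv_imgP[X' BX' ->].
  by rewrite !corner_lfunE -corner_mul ?inP // inA // Balg.
have [Afull|Aproper] := eqVneq A fullv.
  suff ltB : (\dim B < n.+1 ^ 2 + 2)%N.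
    by split=> [|dimB]; [exact: ltnW | rewrite dimB ltnn in ltB].
  rewrite ltnNge; apply/negP => leB.
  case: n => [|n] in B Balg BP BneP Bne0 not_sup A inP inA Aalg Afull leB *; last first.
    by case/negP: not_sup; apply: corner_full_zero_row.
  (* In size 2 the parabolic itself has dimension 3 = n^2 + 2. *)
  case: BneP; apply/eqP; rewrite eqEdim BP /=.
  by apply: leq_trans leB; rewrite -(leq_add2r 1); apply: (dim_parabolic K 1).
have [dimA | [u u0 Au] | [v v0 Av]] := proper_subalg_dim_or_stable Aalg Aproper.
- suff ltB : (\dim B < n.+1 ^ 2 + 2)%N.
    by split=> [|dimB]; [exact: ltnW | rewrite dimB ltnn in ltB].
  (* An element of B with zero corner is supported on the last column. *)
  have := limg_ker_dim (corner_lfun K n.+1) B; rewrite -/A.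
  have : (\dim (B :&: lker (corner_lfun K n.+1)) <= n.+2)%N.
    pose h (t : 'I_n.+2 * 'I_n.+1) := (t.1, lift (@ord_max n.+1) t.2).
    have h_inj : injective h.
      case=> i j [i' j'] E; have /= -> := congr1 fst E.
      by have /= /lift_inj -> := congr1 snd E.
    have := @dim_vanishing _ _ _ _ h (B :&: lker (corner_lfun K n.+1))%VS h_inj.
    rewrite card_prod !card_ord => H.
    suff: (\dim (B :&: lker (corner_lfun K n.+1)) + n.+2 * n.+1 <= n.+2 * n.+2)%N.
      by rewrite [(n.+2 * n.+2)%N]mulnS leq_add2r.
    apply: H => X [i j]; rewrite memv_cap memv_ker corner_lfunE /=.
    case/andP=> BX /eqP cX0; case: (unliftP ord_max i) => [i'|] ->.
      by rewrite -cornerE cX0 mxE.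
    exact/parabolic_entry/inP.
  move: dimA; clear; move: (\dim A) (\dim B) (\dim (_ :&: _)) => a b c; lia.
- have [le_col sim_col] := similar_extremal_col BP u0 (fun X BX => Au _ (inA X BX)).
  split=> [|dimB]; first exact: leq_trans le_col (dim_extremal_col K n).
  by left; apply: sim_col; rewrite dimB dim_extremal_col.
- have [le_row sim_row] := similar_extremal_row BP v0 (fun X BX => Av _ (inA X BX)).
  split=> [|dimB]; first exact: leq_trans le_row (dim_extremal_row K n).
  by right; apply: sim_row; rewrite dimB dim_extremal_row.
Qed.
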